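(* Let $\mathcal U\subset\mathbb R^{n_u}$ and $\mathcal D\subset\mathbb R^{n_d}$ be compact, and let $J:\mathbb R^{n_u}\times\mathbb R^{n_d}\to\mathbb R$, $g_i:\mathbb R^{n_u}\times\mathbb R^{n_d}\to\mathbb R$ ($i=1,\dots,n_g$) and $\mathbf m:\mathbb R^{n_u}\times\mathbb R^{n_d}\to\mathbb R^{n_y}$ be given. Suppose: (H) $n_y=n_u+n_d$; $\mathbf m$ is of class $C^2$; $\mathbf m(0,0)=0$; the Jacobian determinant of $\mathbf m$ with respect to $(\mathbf u,\mathbf d)$ is nonzero at every point; and $\mathbf m$ is proper. (A1) Each $g_i$ is a continuous real-valued function on $\mathcal U\times\mathcal D$, and for every $\mathbf d$, $g_i(\cdot,\mathbf d)$ is convex in $\mathbf u$. (A2) For every $\mathbf d\in\mathcal D$ there exists $\mathbf u\in\mathcal U$ such that $g_i(\mathbf u,\mathbf d)\le 0$ for $i=1,\dots,n_g$. (A3) $J$ is a continuous real-valued function on $\mathcal U\times\mathcal D$. (A4) A numerical method yields an optimal solution for every $\mathbf d\in\mathcal D$, i.e. there is a mapping $\pi:\mathcal D\to\mathcal U$ with $\pi(\mathbf d)\in S_{\mathrm{opt}}(\mathbf d)$ for all $\mathbf d\in\mathcal D$. Then perfect global self-optimizing controlled variables exist; that is, there exists a function $h:\mathbb R^{n_y}\to\mathbb R^{n_u}$ such that $\mathbf c=h(\mathbf y)$ are perfect global self-optimizing controlled variables.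
   Context: The steady-state optimization problem under uncertainty is: for a disturbance $\mathbf d\in\mathcal D$, minimize $J(\mathbf u,\mathbf d)$ over $\mathbf u\in\mathcal U$ subject to $g_i(\mathbf u,\mathbf d)\le 0$, $i=1,\dots,n_g$. The measurements are $\mathbf y=\mathbf m(\mathbf u,\mathbf d)$ (noise-free). Here $\mathbf u$ are the control inputs. Notation: $S_{\mathrm{feas}}(\mathbf d)=\{\mathbf u\in\mathcal U: g_i(\mathbf u,\mathbf d)\le 0,\ i=1,\dots,n_g\}$; $S_{\mathrm{val}}(\mathbf d)=\inf\{J(\mathbf u,\mathbf d):\mathbf u\in S_{\mathrm{feas}}(\mathbf d)\}$; $S_{\mathrm{opt}}(\mathbf d)=\{\mathbf u\in S_{\mathrm{feas}}(\mathbf d): J(\mathbf u,\mathbf d)=S_{\mathrm{val}}(\mathbf d)\}$. The optimal input is $\mathbf u^{\mathrm{opt}}=\pi(\mathbf d)$. Definition (perfect global self-optimizing controlled variables). Functions of the measurements $\mathbf c=h(\mathbf y)$, $h:\mathbb R^{n_y}\to\mathbb R^{n_u}$, are perfect global self-optimizing controlled variables if: (1) controlling $\mathbf c$ to constant setpoints makes the steady-state closed-loop system operate optimally: there is a constant $\mathbf c_s\in\mathbb R^{n_u}$ such that for every $\mathbf d\in\mathcal D$ there is some $\mathbf u\in\mathcal U$ with $h(\mathbf m(\mathbf u,\mathbf d))=\mathbf c_s$, and every $\mathbf u\in\mathcal U$ with $h(\mathbf m(\mathbf u,\mathbf d))=\mathbf c_s$ belongs to $S_{\mathrm{opt}}(\mathbf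 d)$; (2) the inputs $\mathbf u$ have a significant effect (gain) on $\mathbf c$: for every $\mathbf d\in\mathcal D$, the map $\mathbf u\mapsto h(\mathbf m(\mathbf u,\mathbf d))$, defined on $\mathbb R^{n_u}$, is differentiable at $\mathbf u=\pi(\mathbf d)$ and its $n_u\times n_u$ Jacobian matrix there is invertible. *)

(* Defs.v *)
(* MathComp-Analysis; the reals are an arbitrary R : realType. *)
From HB Require Import structures.
From mathcomp Require Import all_boot all_order all_algebra.
From mathcomp Require Import all_classical all_reals all_analysis.

Set Implicit Arguments.
Unset Strict Implicit.
Unset Printing Implicit Defensive.

Import Order.TTheory GRing.Theory Num.Theory.
Import numFieldNormedType.Exports.

Local Open Scope classical_set_scope.
Local Open Scope ring_scope.

(* For finite-dimensional V: the differential x |-> 'd f x is of class C^k iff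
   all the maps x |-> 'd f x v = 'D_v f x are. *)
Fixpoint class_C (R : realType) (V W : normedModType R) (k : nat)
    (f : V -> W) : Prop :=
  match k with
  | 0 => continuous f
  | k'.+1 => (forall x, differentiable f x) /\
             (forall v, class_C k' (fun x => 'D_v f x))
  end.

Definition proper_map (T1 T2 : topologicalType) (f : T1 -> T2) : Prop :=
  continuous f /\ forall K : set T2, compact K -> compact (f @^-1` K).

(* Jacobian matrix of m with respect to the joint variable (u, d) in
   R^(nu + nd); as everywhere in the library, vectors are rows, so row i holds
   the partial derivatives along the i-th coordinate. *)
Definition joint_jacobian (R : realType) (nu nd ny : nat)
    (m : 'rV[R]_nu * 'rV[R]_nd -> 'rV[R]_ny) (ud : 'rV[R]_nu * 'rV[R]_nd) :
    'M[R]_(nu + nd, ny) :=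
  jacobian (fun v : 'rV[R]_(nu + nd) => m (lsubmx v, rsubmx v))
           (row_mx ud.1 ud.2).

Section steady_state_optimization.
Context (R : realType) (nu nd ny ng : nat).
Context (U : set 'rV[R]_nu) (D : set 'rV[R]_nd).
Context (J : 'rV[R]_nu * 'rV[R]_nd -> R).
Context (g : 'I_ng -> 'rV[R]_nu * 'rV[R]_nd -> R).
Context (m : 'rV[R]_nu * 'rV[R]_nd -> 'rV[R]_ny).

Definition S_feas (d : 'rV[R]_nd) : set 'rV[R]_nu :=
  [set u | U u /\ forall i, g i (u, d) <= 0].

Definition S_val (d : 'rV[R]_nd) : \bar R :=
  ereal_inf [set (J (u, d))%:E | u in S_feas d].

Definition S_opt (d : 'rV[R]_nd) : set 'rV[R]_nu :=
  [set u | S_feas d u /\ (J (u, d))%:E = S_val d].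

(* Only the values of pi on D are used. *)
Definition perfect_global_self_optimizing (pi : 'rV[R]_nd -> 'rV[R]_nu)
    (h : 'rV[R]_ny -> 'rV[R]_nu) : Prop :=
  (exists cs : 'rV[R]_nu, forall d, D d ->
      (exists2 u, U u & h (m (u, d)) = cs) /\
      (forall u, U u -> h (m (u, d)) = cs -> S_opt d u)) /\
  (forall d, D d ->
      differentiable (fun u => h (m (u, d))) (pi d) /\
      jacobian (fun u => h (m (u, d))) (pi d) \in unitmx).

End steady_state_optimization.

(* Main.v *)
(* If [m] is injective, any [h] with [h (m (u, d)) = u - pi d] works, with
   setpoint [0] and Jacobian [1]. So everything rests on Hadamard's global
   inversion theorem: a proper C^1 map [f] of R^n to itself with invertible
   Jacobian is injective. Suppose [f a = f b] with [a <> b] and let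
   [phi x = |f x - f a|^2]. Its only critical points are its zeros, and these
   are isolated. Let [c] be the least level such that no pair of disjoint open
   sets separates [a] from [b] in the compact set [phi <= c]. Isolation
   of [a] and compactness give [c > 0]. For small [t > 0] the gradient step
   [x |-> x - t * phi x * grad phi x] fixes the zeros [a] and [b] and sends
   [phi <= c] into some [phi <= c'] with [c' < c]; pulling back a separation at
   level [c'] separates [a] from [b] at level [c], a contradiction. *)
Require Import Defs.
From HB Require Import structures.
From mathcomp Require Import all_boot all_order all_algebra.
From mathcomp Require Import all_classical all_reals all_analysis.
From mathcomp Require Import ring lra.

Set Implicit Arguments.
Unset Strict Implicit.
Unset Printing Implicit Defensive.

Import Order.TTheory GRing.Theory Num.Theory.
Import numFieldNormedType.Exports.

Local Open Scope classical_set_scope.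
Local Open Scope ring_scope.

(** * Separation of two points inside sublevel sets *)

(** [A] and [B] are open in the whole space and disjoint everywhere, so their preimages under a
    continuous map form such a pair again. *)
Definition sublevel_separates (R : realType) (T : topologicalType)
    (phi : T -> R) (a b : T) (r : R) : Prop :=
  exists A B : set T, [/\ open A, open B, A `&` B = set0, A a /\ B b &
    [set x | phi x <= r] `<=` A `|` B].

Section sublevel_separation.
Context (R : realType) (V : normedModType R) (phi : V -> R) (a b : V).
Hypothesis phi_cont : continuous phi.
Hypothesis phi_compact : forall r, compact [set x | phi x <= r].

Lemma sublevel_separates_le r s : r <= s ->
  sublevel_separates phi a b s -> sublevel_separates phi a b r.
Proof.
move=> rs [A [B [oA oB AB0 ab sAB]]]; exists A, B; split => // x /= xr.
by apply: sAB => /=; exact: le_trans rs.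
Qed.

(** A small sphere around [a] misses all zeros of [phi], so its inside and its outside separate at
    level 0. *)
Lemma sublevel_separates_isolated : a != b ->
  (forall x, 0 <= phi x) -> (\forall x \near a, phi x = 0 -> x = a) ->
  sublevel_separates phi a b 0.
Proof.
move=> ab phi0 /nbhs_ballP[e /= e0 ea].
have e2 : 0 < e / 2 by rewrite divr_gt0.
have nc : continuous (fun x : V => `|x - a|).
  by move=> x; apply: cvg_norm; apply: cvgB => //; exact: cvg_cst.
have oL y : open [set x : V | `|x - a| < y].
  by have := iffLR (continuousP _) nc _ (@open_lt _ y).
have oG y : open [set x : V | `|x - a| > y].
  by have := iffLR (continuousP _) nc _ (@open_gt _ y).
(* The first bound keeps the sphere where [a] is the only zero, the second leaves [b] outside. *)
exists [set x | `|x - a| < Order.min (e / 2) (`|b - a| / 2)],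
  [set x | `|x - a| > Order.min (e / 2) (`|b - a| / 2)]; split.
- exact: oL.
- exact: oG.
- by apply/seteqP; split=> // x [/= /lt_trans/[apply]]; rewrite ltxx.
- have ba : 0 < `|b - a| by rewrite normr_gt0 subr_eq0 eq_sym.
  split => /=; first by rewrite subrr normr0 lt_min e2 divr_gt0.
  by rewrite gt_min; apply/orP; right; rewrite gtr_pMr// invf_lt1// ltr1n.
- move=> x /= x0; have {x0}px : phi x = 0 by apply/eqP; rewrite eq_le x0 phi0.
  have [xe|ex] := ltP `|x - a| e.
    left => /=; rewrite (ea x) ?subrr ?normr0//; last first.
      by rewrite -ball_normE/= distrC.
    by rewrite lt_min e2 divr_gt0// normr_gt0 subr_eq0 eq_sym.
  right => /=; rewrite gt_min; apply/orP; left; apply: lt_le_trans ex.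
  by rewrite gtr_pMr// invf_lt1// ltr1n.
Qed.

(** A form of the tube lemma: a compact sublevel set inside an open set stays inside it when the
    level rises slightly. *)
Lemma sublevel_separates_gt r : sublevel_separates phi a b r ->
  exists2 s, r < s & sublevel_separates phi a b s.
Proof.
move=> [A [B [oA oB AB0 ab sAB]]].
have oAB : open (A `|` B) by exact: openU.
(* Level [r + 1] supplies one compact set containing all the sublevel sets in play. *)
have /compact_near_coveringP/near_covering_withinP := @phi_compact (r + 1).
move=> /(_ R r^'+ (fun s x => phi x <= s -> (A `|` B) x) _).
have H x : phi x <= r + 1 ->
  \forall x' \near x & s \near r^'+,
    phi x' <= r + 1 -> phi x' <= s -> (A `|` B) x'.
  move=> _; have [xr|rx] := leP (phi x) r.
    have nx : \forall x' \near x, (A `|` B) x'.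
      by apply: open_nbhs_nbhs; split=> //; exact: sAB.
    exists ((A `|` B), setT) => /=; first by split=> //; exact: filterT.
    by move=> [x' s] [].
  (* Above level [r] the claim is vacuous: near [x] the values of [phi] exceed [q], while levels
     near [r] stay below it. *)
  pose q := (phi x + r) / 2.
  have rq : r < q by rewrite /q; lra.
  have qx : q < phi x by rewrite /q; lra.
  exists ([set x' | q < phi x'], [set s | s < q]) => /=.
    split; last exact: nbhs_right_lt.
    exact: (cvgr_gt _ (@phi_cont x)).
  move=> [x' s] [/= qx' sq] _ x's.
  by have := lt_le_trans qx' x's; rewrite ltNge (ltW sq).
move=> /(_ H) ns.
near r^'+ => s; exists s; first by near: s; exact: nbhs_right_gt.
exists A, B; split => // x /= xs; suff: phi x <= r + 1.
  by move=> xr; exact: (near ns s).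
by apply: le_trans xs _; near: s; apply: nbhs_right_le; rewrite ltrDl.
Unshelve. all: by end_near. Qed.

(** The segment from [a] to [b] is connected and lies in the sublevel set of the maximum of [phi] on
    it. *)
Lemma segment_sublevel_nseparated : exists r, ~ sublevel_separates phi a b r.
Proof.
pose p (t : R) : V := a + t *: (b - a).
have p_cont : continuous p.
  move=> t; apply: cvgD; first exact: cvg_cst.
  by apply: cvgZr_tmp; exact: cvg_id.
have pp_cont : continuous (phi \o p).
  by move=> t; apply: continuous_comp; [exact: p_cont|exact: phi_cont].
have [c _ cmax] := EVT_max ler01 (continuous_subspaceT pp_cont).
exists (phi (p c)) => -[A [B [oA oB AB0 [Aa Bb] sAB]]].
have p0 : p 0 = a by rewrite /p scale0r addr0.
have p1 : p 1 = b by rewrite /p scale1r addrC subrK.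
have oAp : open (p @^-1` A) by apply: (iffLR (continuousP _) p_cont).
have oBp : open (p @^-1` B) by apply: (iffLR (continuousP _) p_cont).
have pAB t : t \in `[0, 1]%R -> A (p t) \/ B (p t).
  by move=> t01; apply: sAB; exact: cmax.
have : p @^-1` A `&` `[0, 1] = `[0, 1]%classic.
  apply: (@segment_connected R 0 1).
  - by exists 0; split => /=; rewrite ?p0// in_itv/= lexx ler01.
  - by exists (p @^-1` A); rewrite 1?setIC.
  (* Within [[0, 1]] the preimage of [A] is the complement of that of [B], hence relatively
     closed. *)
  - exists (~` (p @^-1` B)); first exact: open_closedC.
    rewrite setIC; apply/seteqP; split => t [t01 /= ABt]; split => //.
      by move=> Bt; have : (A `&` B) (p t) by []; rewrite AB0.
    by have [] := pAB _ t01.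
move/seteqP => [_ /(_ 1)]; rewrite /= in_itv/= lexx ler01 p1 => /(_ isT)[Ab _].
by have : (A `&` B) b by []; rewrite AB0.
Qed.

Lemma mountain_pass_eq :
  (forall x, 0 <= phi x) -> phi a = 0 ->
  (\forall x \near a, phi x = 0 -> x = a) ->
  (forall c, 0 < c -> exists eta : V -> V,
    [/\ continuous eta, eta a = a, eta b = b &
        forall x, phi x <= c -> phi (eta x) < c]) -> a = b.
Proof.
move=> phi0 phia a_isol descent; apply/eqP/negP => /negP ab.
have [M nM] := segment_sublevel_nseparated.
pose S := [set r | sublevel_separates phi a b r].
have S0 : S 0 by exact: sublevel_separates_isolated.
have ubM : ubound S M.
  move=> r Sr; rewrite leNgt; apply/negP => Mr; apply: nM.
  exact: sublevel_separates_le (ltW Mr) Sr.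
have supS : has_sup S by split; [exists 0|exists M].
have lt_sup r : r < sup S -> S r.
  move=> rS; have := sup_adherent (eps := sup S - r); rewrite subr_gt0.
  move=> /(_ _ rS supS)[s Ss]; rewrite subKr => rs.
  exact: sublevel_separates_le (ltW rs) Ss.
(* Separation persists at slightly higher levels, so a supremum cannot be attained. *)
have nSsup : ~ S (sup S).
  move=> /sublevel_separates_gt[s + Ss]; rewrite ltNge => /negP; apply.
  exact: sup_upper_bound.
have sup0 : 0 < sup S.
  rewrite lt_neqAle; apply/andP; split; last exact: sup_upper_bound.
  by apply/eqP => S0'; apply: nSsup; rewrite -S0'.
have [eta [eta_cont etaa etab eta_lt]] := descent _ sup0.
have K0 : [set x | phi x <= sup S] !=set0 by exists a; rewrite /= phia ltW.
have pe_cont : continuous (phi \o eta).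
  by move=> y; apply: continuous_comp; [exact: eta_cont|exact: phi_cont].
(* Compactness makes the strict pointwise drop uniform: the maximum of [phi \o eta], attained at
   [x], is a level below [sup S]. *)
have [x /set_mem xS xmax] := compact_EVT_max K0 (@phi_compact (sup S))
  (continuous_subspaceT pe_cont).
have [A [B [oA oB AB0 [Aa Bb] sAB]]] := lt_sup _ (eta_lt _ xS).
apply: nSsup; exists (eta @^-1` A), (eta @^-1` B); split.
- by apply: (iffLR (continuousP _) eta_cont).
- by apply: (iffLR (continuousP _) eta_cont).
- by rewrite -preimage_setI AB0 preimage_set0.
- by rewrite /= etaa etab.
- by move=> y yS; apply: sAB; apply: xmax; exact/mem_set.
Qed.

End sublevel_separation.

(** * Gradient descent with a uniform step *)

Lemma continuous_add_scale (R : realType) (V : normedModType R) (W : V -> V)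
  (t : R) : continuous W -> continuous (fun x => x + t *: W x).
Proof.
move=> W_cont x; apply: cvgD; first exact: cvg_id.
by apply: cvgZl_tmp; exact: W_cont.
Qed.

Lemma continuous_scale_cst (R : realType) (T : topologicalType)
    (V : normedModType R) (k : T -> R) (w : V) :
  continuous k -> continuous (fun x => k x *: w).
Proof. by move=> k_cont x; apply: cvgZr_tmp; exact: k_cont. Qed.

Definition gradient (R : realType) (n : nat) (phi : 'rV[R]_n -> R)
    (x : 'rV[R]_n) : 'rV[R]_n :=
  \row_i 'D_(delta_mx 0 i) phi x.

Section gradient_descent.
Context (R : realType) (n : nat) (phi : 'rV[R]_n -> R).
Hypothesis phi_diff : forall x, differentiable phi x.
Hypothesis phi_C1 : forall v, continuous (fun x => 'D_v phi x).

Lemma deriveEgradient v x : 'D_v phi x = \sum_i v 0 i * gradient phi x 0 i.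
Proof.
rewrite deriveE// [in LHS](row_sum_delta v) linear_sum.
by apply: eq_bigr => i _; rewrite linearZ/= mxE deriveE.
Qed.

Lemma gradient_continuous : continuous (gradient phi).
Proof.
have -> : gradient phi =
    fun x => \sum_i 'D_(delta_mx 0 i) phi x *: delta_mx 0 i.
  apply/funext => x; rewrite [LHS]row_sum_delta.
  by apply: eq_bigr => i _; rewrite mxE.
apply: continuous_big => [|i _]; first exact: add_continuous.
exact: continuous_scale_cst.
Qed.

Lemma is_derive_line (x w : 'rV[R]_n) (s : R) :
  is_derive s 1 (fun t : R => phi (x + t *: w)) ('D_w phi (x + s *: w)).
Proof.
have E : (fun h : R => h^-1 *:
    (((fun t : R => phi (x + t *: w)) \o shift s) (h *: 1) - phi (x + s *: w)))
  = (fun h : R => h^-1 *: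
    ((phi \o shift (x + s *: w)) (h *: w) - phi (x + s *: w))).
  apply/funext => h /=; rewrite [h *: 1]mulr1; congr (_ *: (phi _ - _)).
  by rewrite scalerDl addrCA.
apply: DeriveDef.
  by rewrite /derivable E; exact: diff_derivable.
by rewrite /derive E.
Qed.

Lemma gradient_step (x w : 'rV[R]_n) (t : R) : 0 < t ->
  (forall s, 0 < s < t -> 'D_w phi (x + s *: w) < 0) -> phi (x + t *: w) < phi x.
Proof.
move=> t0 neg; have D := is_derive_line x w.
have [|u /[!in_itv]/= /neg uneg] := MVT t0 (fun s _ => D s).
  apply: continuous_subspaceT => s.
  by apply/differentiable_continuous/derivable1_diffP; case: (D s).
rewrite scale0r addr0 subr0 => E.
by rewrite -subr_lt0 E pmulr_llt0.
Qed.

(** One step length must serve the whole sublevel set: near each point all small lengths work, and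
    compactness gives a common one. *)
Lemma gradient_descent c : 0 < c ->
  (forall x, 0 < phi x -> exists v, 'D_v phi x != 0) ->
  compact [set x | phi x <= c] ->
  exists eta : 'rV[R]_n -> 'rV[R]_n,
    [/\ continuous eta, forall x, phi x = 0 -> eta x = x &
        forall x, phi x <= c -> phi (eta x) < c].
Proof.
move=> c0 noncrit Kc.
(* The factor [phi x] makes [W] vanish at the zeros of [phi]; on the level [c] it is a positive
   constant and keeps a descent direction. *)
pose W (x : 'rV[R]_n) : 'rV[R]_n := - (phi x *: gradient phi x).
have phi_cont : continuous phi.
  by move=> x; exact: differentiable_continuous.
have W_cont : continuous W.
  by move=> x; exact: (cvgN (cvgZ (@phi_cont x) (@gradient_continuous x))).
have fst_cvg (x : 'rV[R]_n) : (fun p : 'rV[R]_n * R => p.1)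
    @ filter_prod (nbhs x) 0^'+ --> x.
  exact: cvg_fst.
have pair_cvg (x : 'rV[R]_n) : (fun p : 'rV[R]_n * R => p.1 + p.2 *: W p.1)
    @ filter_prod (nbhs x) 0^'+ --> x.
  suff : (fun p : 'rV[R]_n * R => p.1 + p.2 *: W p.1)
      @ filter_prod (nbhs x) 0^'+ --> x + 0 *: W x by rewrite scale0r addr0.
  have c2 : (fun p : 'rV[R]_n * R => p.2) @ filter_prod (nbhs x) 0^'+ --> (0 : R).
    by move=> P P0; apply: cvg_snd; exact: cvg_within.
  exact: (cvgD (@fst_cvg x) (cvgZ c2 (cvg_comp _ _ (@fst_cvg x) (@W_cont x)))).
have near_desc : \forall t \near 0^'+,
    [set x | phi x <= c] `<=` (fun x => phi (x + t *: W x) < c).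
  move/compact_near_coveringP/near_covering_withinP : Kc; apply => x /=.
  (* Strictly below [c] continuity suffices; on the level [c] the sign of the derivative decides. *)
  rewrite le_eqVlt => /predU1P[xc|xc]; last first.
    have : phi (p.1 + p.2 *: W p.1) @[p --> filter_prod (nbhs x) 0^'+] --> phi x.
      exact: (cvg_comp _ _ (@pair_cvg x) (@phi_cont x)).
    move=> phi_cvg; have [AB nAB sAB] := cvgr_lt _ phi_cvg _ xc.
    by exists AB => // p /sAB.
  (* [G (y, s)] is the derivative of [phi] along [W y] at [y + s *: W y]; it tends to a negative
     number at [(x, 0)]. *)
  pose G (p : 'rV[R]_n * R) :=
    \sum_i W p.1 0 i * gradient phi (p.1 + p.2 *: W p.1) 0 i.
  have Gcvg : G p @[p --> filter_prod (nbhs x) 0^'+] -->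
      \sum_i W x 0 i * gradient phi x 0 i.
    apply: cvg_big => [|i _]; first exact: add_continuous.
    have Wx : W p.1 @[p --> filter_prod (nbhs x) (0 : R)^'+] --> W x.
      exact: (cvg_comp _ _ (@fst_cvg x) (@W_cont x)).
    exact: (cvgM (cvg_comp _ _ Wx (@coord_continuous _ _ _ 0 i (W x)))
      (cvg_comp _ _ (cvg_comp _ _ (@pair_cvg x) (@gradient_continuous x))
        (@coord_continuous _ _ _ 0 i _))).
  have Gx : \sum_i W x 0 i * gradient phi x 0 i < 0.
    have -> : \sum_i W x 0 i * gradient phi x 0 i =
        - (c * \sum_i gradient phi x 0 i ^+ 2).
      rewrite mulr_sumr -sumrN; apply: eq_bigr => i _.
      by rewrite !mxE xc expr2 mulrA mulNr.
    rewrite oppr_lt0 pmulr_rgt0// lt_neqAle eq_sym sumr_ge0 ?andbT; last first.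
      by move=> i _; exact: sqr_ge0.
    apply/negP => /eqP/psumr_eq0P pE.
    have [|v /eqP] := noncrit x; first by rewrite xc.
    rewrite deriveEgradient; apply; apply: big1 => i _.
    have /eqP := pE (fun i _ => sqr_ge0 _) i isT.
    by rewrite sqrf_eq0 => /eqP ->; rewrite mulr0.
  have /= [[A B] /= [nA nB] AB] := cvgr_lt _ Gcvg _ Gx.
  have [e /= e0 eB] := nB.
  (* The interval starts at 0, so with [t] it contains every [s] between 0 and [t], as
     [gradient_step] requires. *)
  exists (A, [set t | 0 < t < e]) => /=.
    split => //; near=> t; apply/andP; split; near: t.
      exact: nbhs_right_gt.
    exact: nbhs_right_lt.
  move=> [y t] /= [Ay /andP[t0 te]] yc.
  apply: lt_le_trans yc; apply: gradient_step t0 _ => s /andP[s0 st].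
  rewrite deriveEgradient; apply: (AB (y, s)); split => //=.
  by apply: eB => //=; rewrite sub0r normrN gtr0_norm// (lt_trans st).
near (0 : R)^'+ => t; exists (fun x => x + t *: W x); split.
- exact: continuous_add_scale.
- by move=> x x0; rewrite /W x0 scale0r oppr0 scaler0 addr0.
- by near: t.
Unshelve. all: by end_near. Qed.

End gradient_descent.

(** * Isolated preimages where the differential is invertible *)

(** If [f (a + h) = f a], the first-order remainder is [- 'd f a h], of norm at most [|h| / (2 * k)]
    for small [h]; the lower bound on the differential then gives [|h| <= |h| / 2]. *)
Lemma differentiable_isolated (R : realType) (V W : normedModType R)
    (f : V -> W) (a : V) (k : R) :
  differentiable f a -> 0 < k -> (forall h, `|h| <= k * `|'d f a h|) ->
  \forall x \near a, f x = f a -> x = a.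
Proof.
move=> df k0 dk; have /diff_locallyP[_ /eqaddoP o] := df.
have k20 : 0 < (2 * k)^-1 by rewrite invr_gt0 mulr_gt0.
have := o _ k20 => {}o; rewrite nbhs0P.
near=> h => /= fah; have : `|(f \o shift a - (cst (f a) + 'd f a)) h| <=
  (2 * k)^-1 * `|h| by near: h.
rewrite !fctE /= [h + a]addrC fah opprD addNKr normrN => dh.
have : `|h| <= 2^-1 * `|h|.
  apply: le_trans (dk h) _.
  by rewrite -ler_pdivlMl// mulrA -invfM [k * 2]mulrC.
have [->|h0] := eqVneq h 0; first by rewrite addr0.
rewrite -[leLHS]mul1r ler_pM2r ?normr_gt0// => /le_lt_trans.
by move=> /(_ 1); rewrite invf_lt1// ltr1n ltxx => /(_ isT).
Unshelve. all: by end_near. Qed.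

Lemma mulmx_lipschitz (R : realType) n p (A : 'M[R]_(n, p)) :
  exists2 k : R, 0 < k & forall v : 'rV[R]_n, `|v *m A| <= k * `|v|.
Proof.
(* The summand 1 keeps the constant positive even when [A] is zero. *)
exists (1 + \sum_i `|row i A|) => [|v]; first by rewrite ltr_pwDl// sumr_ge0.
have le_coord i : `|v 0 i| <= `|v|.
  by rewrite [leRHS]/Num.norm/= mx_normrE; exact: (le_bigmax _ _ (0, i)).
rewrite mulmx_sum_row mulrDl mul1r mulr_suml.
apply: le_trans (ler_norm_sum _ _ _) _; apply: ler_wpDl => //.
by apply: ler_sum => i _; rewrite normrZ mulrC ler_wpM2l.
Qed.

Lemma unit_jacobian_isolated (R : realType) n (f : 'rV[R]_n -> 'rV[R]_n) a :
  differentiable f a -> jacobian f a \in unitmx ->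
  \forall x \near a, f x = f a -> x = a.
Proof.
move=> df uJ; have [k k0 kA] := mulmx_lipschitz (invmx (jacobian f a)).
apply: (differentiable_isolated df k0) => h.
by have := kA ('d f a h); rewrite -(deriveE h df) (deriveEjacobian h df) mulmxK.
Qed.

(** * Squared distance from a map to a point *)

(** A sum of squares, since the norm of row vectors is the maximum norm, which is not differentiable
    in general. *)
Definition sqdist (R : realType) (T : Type) (p : nat) (f : T -> 'rV[R]_p)
    (y : 'rV[R]_p) (x : T) : R :=
  \sum_j (f x 0 j - y 0 j) ^+ 2.

Section squared_distance.
Context (R : realType) (V : normedModType R) (p : nat).
Context (f : V -> 'rV[R]_p) (y : 'rV[R]_p).
Hypothesis f_diff : forall x, differentiable f x.
Hypothesis f_C1 : forall v, continuous (fun x => 'D_v f x).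

Let coord_diff x j : differentiable (fun x => f x 0 j - y 0 j) x.
Proof.
apply: differentiableB => //.
exact: (differentiable_comp (f_diff x) (differentiable_coord _ 0 j)).
Qed.

Let derive_coord v x j :
  'D_v (fun x => f x 0 j - y 0 j) x = ('D_v f x) 0 j.
Proof.
have fd : derivable f x v by exact: diff_derivable.
rewrite deriveB//; last by move/derivable_mxP : fd; exact.
by rewrite derive_cst subr0 derive_mx// mxE.
Qed.

Let sqdistE : sqdist f y = \sum_j (fun x => f x 0 j - y 0 j) ^+ 2.
Proof. by apply/funext => x; rewrite fct_sumE. Qed.

Lemma differentiable_sqdist x : differentiable (sqdist f y) x.
Proof.
rewrite sqdistE; apply: differentiable_sum => j.
exact/differentiableX/coord_diff.
Qed.

Lemma derive_sqdist v x :
  'D_v (sqdist f y) x = 2 * \sum_j (f x 0 j - y 0 j) * ('D_v f x) 0 j.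
Proof.
have cd j : derivable (fun x => f x 0 j - y 0 j) x v by exact: diff_derivable.
rewrite sqdistE derive_sum => [|j]; last exact: derivableX.
rewrite mulr_sumr; apply: eq_bigr => j _.
by rewrite deriveX// derive_coord expr1 mulrA.
Qed.

Lemma derive_sqdist_continuous v : continuous ('D_v (sqdist f y)).
Proof.
have -> : 'D_v (sqdist f y) = fun x =>
    \sum_j 2 * ((f x 0 j - y 0 j) * ('D_v f x) 0 j).
  by apply/funext => x; rewrite derive_sqdist mulr_sumr.
apply: continuous_big => [|j _ x]; first exact: add_continuous.
have F_cont := differentiable_continuous (coord_diff x j).
have D_cont : ('D_v f z) 0 j @[z --> x] --> ('D_v f x) 0 j.
  exact: (cvg_comp _ _ (@f_C1 v x) (@coord_continuous _ _ _ 0 j _)).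
by apply: cvgM; [exact: cvg_cst|apply: cvgM; [exact: F_cont|exact: D_cont]].
Qed.

Lemma sqdist_ge0 x : 0 <= sqdist f y x.
Proof. by apply: sumr_ge0 => j _; exact: sqr_ge0. Qed.

Lemma sqdist_eq0 x : sqdist f y x = 0 -> f x = y.
Proof.
move=> /psumr_eq0P E; apply/rowP => j; apply/eqP.
by rewrite -subr_eq0 -sqrf_eq0 E// => i _; exact: sqr_ge0.
Qed.

Lemma sqdist_compact r : (forall K, compact K -> compact (f @^-1` K)) ->
  compact [set x | sqdist f y x <= r].
Proof.
move=> f_proper.
(* Half-width [r + 1] avoids a square root: [r <= (r + 1) ^+ 2] for [r >= 0]. *)
have box := @rV_compact R p
  (fun j => `[y 0 j - (r + 1), y 0 j + (r + 1)]%classic)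
  (fun=> @segment_compact R _ _).
apply: (subclosed_compact _ (f_proper _ box)).
  have d2c : continuous (sqdist f y).
    by move=> x; exact/differentiable_continuous/differentiable_sqdist.
  exact: (iffLR (continuous_closedP _) d2c _ (@closed_le _ r)).
move=> x /= xr j; rewrite in_itv/= -ler_distl.
have r0 : 0 <= r by exact: le_trans (sqdist_ge0 x) xr.
have le_r : `|f x 0 j - y 0 j| ^+ 2 <= r.
  rewrite real_normK ?num_real//; apply: le_trans xr.
  by rewrite /sqdist (bigD1 j)//= lerDl sumr_ge0// => i _; exact: sqr_ge0.
rewrite -(ler_pXn2r (n := 2)) ?nnegrE ?addr_ge0//.
by apply: le_trans le_r _; rewrite expr2; nra.
Qed.

End squared_distance.

(** * Global injectivity *)

Theorem proper_unit_jacobian_injective (R : realType) (n : nat)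
    (f : 'rV[R]_n -> 'rV[R]_n) :
  (forall x, differentiable f x) -> (forall v, continuous ('D_v f)) ->
  (forall x, jacobian f x \in unitmx) ->
  (forall K, compact K -> compact (f @^-1` K)) -> injective f.
Proof.
move=> f_diff f_C1 f_unit f_proper a b fab.
pose phi := sqdist f (f a).
have phi_diff x : differentiable phi x by exact: differentiable_sqdist.
have phi_eq0 x : f x = f a -> phi x = 0.
  by move=> fx; rewrite /phi /sqdist fx big1// => j _; rewrite subrr expr0n.
have phi_C1 v : continuous ('D_v phi) by exact: derive_sqdist_continuous.
have phi_compact r : compact [set x | phi x <= r] by exact: sqdist_compact.
have noncrit x : 0 < phi x -> exists v, 'D_v phi x != 0.
  (* The Newton direction: the derivative of [f] along it is [f x - f a], so that of [phi] is
     [2 * phi x]. *)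
  move=> phix; exists ((f x - f a) *m invmx (jacobian f x)).
  rewrite derive_sqdist// deriveEjacobian// mulmxKV//.
  have -> : \sum_j (f x 0 j - f a 0 j) * (f x - f a) 0 j = phi x.
    by apply: eq_bigr => j _; rewrite !mxE expr2.
  by rewrite mulf_neq0 ?gt_eqF.
apply: (@mountain_pass_eq _ _ phi) => //.
- by move=> x; exact/differentiable_continuous.
- exact: sqdist_ge0.
- exact: phi_eq0.
- near=> x => /sqdist_eq0; near: x; exact: unit_jacobian_isolated.
- move=> c c0; have [eta [eta_cont eta_fix eta_lt]] :=
    gradient_descent phi_diff phi_C1 c0 noncrit (phi_compact c).
  by exists eta; split => //; apply: eta_fix; exact: phi_eq0.
Unshelve. all: by end_near. Qed.

Lemma row_mx_continuous (R : realType) n p :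
  continuous (fun ud : 'rV[R]_n * 'rV[R]_p => row_mx ud.1 ud.2).
Proof.
move=> ud A /nbhs_ballP[e /= e0 eA].
apply/nbhs_ballP; exists e => //= v [[_ uv] [_ dv]]; apply: eA; split => // i j.
by rewrite !mxE; case: splitP => k _; [exact: uv|exact: dv].
Qed.

(** Pairs are identified with row vectors by the linear map [split], along which all assumptions on
    [m] transfer. *)
Lemma joint_injective (R : realType) (nu nd : nat)
    (m : 'rV[R]_nu * 'rV[R]_nd -> 'rV[R]_(nu + nd)) :
  class_C 2 m -> (forall ud, joint_jacobian m ud \in unitmx) ->
  proper_map m -> injective m.
Proof.
move=> [m_diff m_C1] m_unit [_ m_proper].
pose split (v : 'rV[R]_(nu + nd)) := (lsubmx v, rsubmx v).
have split_diff x : differentiable split x.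
  exact: differentiable_pair (differentiable_lsubmx x) (differentiable_rsubmx x).
have derive_split v x : 'D_v (m \o split) x = 'D_(split v) m (split x).
  have E : (fun h : R => h^-1 *:
      (((m \o split) \o shift x) (h *: v) - (m \o split) x))
    = (fun h : R => h^-1 *:
      ((m \o shift (split x)) (h *: split v) - m (split x))).
    apply/funext => h /=; congr (_ *: (m _ - _)).
    by rewrite /split !linearD !linearZ.
  by rewrite /derive E.
have m_split_inj : injective (m \o split).
  apply: proper_unit_jacobian_injective.
  - by move=> x; exact: differentiable_comp.
  - move=> v.
    have -> : 'D_v (m \o split) = 'D_(split v) m \o split.
      by apply/funext => x; exact: derive_split.
    move=> x; apply: continuous_comp.
      exact: differentiable_continuous.
    by apply: differentiable_continuous; have [] := m_C1 (split v).
  - by move=> x; have := m_unit (split x); rewrite /joint_jacobian /= hsubmxK.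
  - move=> K /m_proper cK.
    (* Properness transfers because the inverse of [split] is continuous. *)
    have -> : (m \o split) @^-1` K =
        (fun ud => row_mx ud.1 ud.2) @` (m @^-1` K).
      apply/seteqP; split => [v Kv|_ [ud Kud <-]].
        by exists (split v) => //; rewrite /split hsubmxK.
      by rewrite /= /split row_mxKl row_mxKr -surjective_pairing.
    apply: continuous_compact cK; apply: continuous_subspaceT.
    exact: row_mx_continuous.
move=> [u d] [u' d'] mE.
have : row_mx u d = row_mx u' d'.
  by apply: m_split_inj; rewrite /= /split !row_mxKl !row_mxKr.
by move=> /eq_row_mx[-> ->].
Qed.

(** * Construction of the controlled variables *)

Theorem theorem5 (R : realType) (nu nd ny ng : nat)
    (U : set 'rV[R]_nu) (D : set 'rV[R]_nd)
    (J : 'rV[R]_nu * 'rV[R]_nd -> R)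
    (g : 'I_ng -> 'rV[R]_nu * 'rV[R]_nd -> R)
    (m : 'rV[R]_nu * 'rV[R]_nd -> 'rV[R]_ny)
    (pi : 'rV[R]_nd -> 'rV[R]_nu)
    (U_compact : compact U) (D_compact : compact D)
    (* (H) *)
    (dim_y : ny = (nu + nd)%N)
    (m_C2 : class_C 2 m)
    (m_0 : m (0, 0) = 0)
    (m_jac : forall ud,
       \det (castmx (erefl (nu + nd)%N, dim_y) (joint_jacobian m ud)) != 0)
    (m_proper : proper_map m)
    (* (A1) *)
    (g_cont : forall i, {within U `*` D, continuous (g i)})
    (g_convex : forall i d, D d ->
       convex_function [set: 'rV[R]_nu] (fun u => g i (u, d)))
    (* (A2) *)
    (feasible : forall d, D d ->
       exists2 u, U u & forall i, g i (u, d) <= 0)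
    (* (A3) *)
    (J_cont : {within U `*` D, continuous J})
    (* (A4) *)
    (pi_opt : forall d, D d -> S_opt U J g d (pi d)) :
  exists h : 'rV[R]_ny -> 'rV[R]_nu,
    perfect_global_self_optimizing U D J g m pi h.
Proof.
subst ny.
have m_inj : injective m.
  apply: joint_injective => // ud.
  by have := m_jac ud; rewrite castmx_id unitmxE unitfE.
have [h hE] : {h : 'rV[R]_(nu + nd) -> 'rV[R]_nu &
    forall y ud, m ud = y -> h y = ud.1 - pi ud.2}.
  (* One value must suit all preimages of [y]; injectivity of [m] ensures this. *)
  apply: (@choice _ _ (fun y c => forall ud, m ud = y -> c = ud.1 - pi ud.2)).
  move=> y.
  have [[ud mud]|ny] := pselect (exists ud, m ud = y).
    by exists (ud.1 - pi ud.2) => ud'; rewrite -mud => /m_inj ->.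
  (* Off the range of [m] the value 0 is an arbitrary default. *)
  by exists 0 => ud mud; exfalso; apply: ny; exists ud.
exists h; split.
  exists 0 => d Dd; split.
    exists (pi d); first by have [[]] := pi_opt d Dd.
    by rewrite (hE _ (pi d, d))//= subrr.
  move=> u Uu; rewrite (hE _ (u, d))//= => /eqP; rewrite subr_eq0 => /eqP ->.
  exact: pi_opt.
move=> d Dd.
(* The equality holds for every [u], also outside [U]; the composite is a translation, whatever the
   regularity of [h]. *)
have -> : (fun u => h (m (u, d))) = (fun u => u - pi d).
  by apply/funext => u; rewrite (hE _ (u, d)).
have sub_diff : is_diff (pi d) (fun u => u - pi d) (id - 0).
  exact: is_diffB.
split; first exact: ex_diff.
have -> : jacobian (fun u => u - pi d) (pi d) = 1%:M.
  apply/row_matrixP => i; rewrite rowE -deriveEjacobian// deriveE//.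
  by rewrite diff_val row1 !fctE subr0.
exact: unitmx1.
Qed.
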